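(* Let $G$ be a finite group, $\mathcal F$ a family of subgroups of $G$, and $R$ a principal ideal domain. Let $\underline n\colon\mathcal S(G)\to\mathbb Z$ be a conjugation-invariant function supported on $\mathcal F$ and let $\mathbf C$ be a finite projective chain complex over $R\Gamma_G$ which is an $R$-homology $\underline n$-sphere. If the equality $\underline n=\operatorname{Dim}\mathbf C$ holds, then $\mathbf C$ is an algebraic homotopy representation over $R$.
   Context: $\mathcal S(G)$ is the set of all subgroups of $G$. A family $\mathcal F$ is a nonempty set of subgroups of $G$ closed under conjugation and taking subgroups. $\Gamma_G=\operatorname{Or}_{\mathcal F}G$ is the orbit category: objects are the orbits $G/K$ with $K\in\mathcal F$, morphisms are $G$-maps. An $R\Gamma_G$-module is a contravariant functor $M$ from $\Gamma_G$ to $R$-modules; write $M(K)=M(G/K)$. For $H\in\mathcal F$, $R[G/H^{?}]$ is the module $K\mapsto R[(G/H)^K]$; free modules are direct sums of such, projective modules are the direct summands of free ones. Chain complexes $\mathbf C$ are non-negative; $\mathbf C$ is finite if $\mathbf C_i=0$ for all large $i$ and every $\mathbf C_i$ is finitely generated; projective if every $\mathbf C_i$ is. $\operatorname{Dim}\mathbf C\colon\mathcal S(G)\to\mathbb Z$ is given by: for $H\in\mathcal F$, $(\operatorname{Dim}\mathbf C)(H)$ is the largest $d$ with $\mathbf C_d(H)\neq0$ (and $-1$ if $\mathbf C(H)=0$); for $H\notin\mathcal F$ it is $-1$. A function $\underline n$ is supported on $\mathcal F$ if $\underline n(H)=-1$ for all $H\notin\mathcal F$. $\underline R$ is the constant functor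 with value $R$. An augmentation of $\mathbf C$ is a map $\varepsilon\colon\mathbf C_0\to\underline R$ with $\varepsilon\circ\partial_1=0$ such that $\varepsilon(H)$ is surjective whenever $\mathbf C(H)\ne0$; reduced homology is the homology of the augmented complex with $\underline R$ in degree $-1$. $\mathbf C$ is an $R$-homology $\underline n$-sphere if it has an augmentation such that for every $K\in\mathcal F$ the reduced homology of $\mathbf C(K)$ is that of an $\underline n(K)$-sphere with coefficients in $R$ (i.e. $R$ in degree $\underline n(K)\ge-1$ and zero otherwise; $S^{-1}=\emptyset$). Write $(H)\le(K)$ if $g^{-1}Hg\le K$ for some $g\in G$. A finite projective chain complex $\mathbf C$ which is an $R$-homology $\underline n$-sphere is an algebraic homotopy representation (over $R$) if: (i) $\underline n$ is monotone, i.e. $\underline n(H)\ge\underline n(K)$ whenever $(H)\le(K)$; (ii) if $H,K\in\mathcal F$ satisfy $\underline n(K)=\underline n(H)$, then for every $G$-map $f\colon G/H\to G/K$ the induced map $\mathbf C(f)\colon\mathbf C(K)\to\mathbf C(H)$ is an $R$-homology isomorphism; (iii) if $H,K,L\in\mathcal F$ satisfy $H\le K$, $H\le L$ and $n=\underline n(H)=\underline n(K)=\underline n(L)>-1$, then $M=\langle K,L\rangle\in\mathcal F$ and $\underline n(M)=n$. *)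

(* Defs.v *)
From HB Require Import structures.
From mathcomp Require Import all_boot all_order all_algebra all_fingroup.
From mathcomp Require Import generic_quotient ring_quotient.
From mathcomp Require Import boolp classical_sets.

Set Implicit Arguments.
Unset Strict Implicit.
Unset Printing Implicit Defensive.

Import Order.TTheory GRing.Theory Num.Theory.
Local Open Scope quotient_scope.
Local Open Scope ring_scope.

(* Ideals are arbitrary Prop-valued predicates, and the unit ideal is allowed. *)
Definition is_ideal (R : idomainType) (I : R -> Prop) : Prop :=
  [/\ I 0, forall x y, I x -> I y -> I (x + y) & forall a x, I x -> I (a * x)].

Definition is_pid (R : idomainType) : Prop :=
  forall I : R -> Prop, is_ideal I ->
    exists a, forall x, I x <-> exists r, x = r * a.

Section Modules.
Variable R : nzRingType.

Definition zero_module (V : lmodType R) : Prop := forall x : V, x = 0.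

Definition isomorphic_modules (V W : lmodType R) : Prop :=
  exists f : {linear V -> W}, bijective f.

(* Non-negative chain complexes; [bd C i] goes from degree i + 1 to degree i. *)
Record chain := Chain {
  chain_ob :> nat -> lmodType R;
  bd : forall i, {linear chain_ob i.+1 -> chain_ob i};
  bd_bd : forall i x, bd i (bd i.+1 x) = 0
}.

Section Homology.
Variables (C : chain) (i : nat).

Definition is_cycle : pred (C i) :=
  match i return pred (C i) with
  | 0 => fun _ => true
  | j.+1 => fun x => bd C j x == 0
  end.

Lemma is_cycle_submod_closed : GRing.submod_closed is_cycle.
Proof.
rewrite /is_cycle; case: i => [|j]; first by [].
split; first by apply/eqP; rewrite raddf0.
move=> a x y /eqP hx /eqP hy; apply/eqP.
by rewrite linearP hx hy scaler0 addr0.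
Qed.

HB.instance Definition _ :=
  GRing.isSubmodClosed.Build R (C i) is_cycle is_cycle_submod_closed.

Definition cycles : Type := {x : C i | x \in is_cycle}.
HB.instance Definition _ := SubChoice.on cycles.
HB.instance Definition _ := [SubChoice_isSubLmodule of cycles by <:].

Definition is_boundary : pred cycles :=
  fun z => `[< exists y, bd C i y = val z >].

Lemma is_boundary_submod_closed : GRing.submod_closed is_boundary.
Proof.
split; first by apply/asboolP; exists 0; rewrite !raddf0.
move=> a u v /asboolP [x hx] /asboolP [y hy]; apply/asboolP.
by exists (a *: x + y); rewrite linearP hx hy linearP.
Qed.

HB.instance Definition _ :=
  GRing.isSubmodClosed.Build R cycles is_boundary is_boundary_submod_closed.

Definition boundaries : zmodClosed cycles :=
  GRing.ZmodClosed.clone cycles is_boundary _.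

Definition homology : Type := Quotient.quot boundaries.
HB.instance Definition _ := GRing.Zmodule.on homology.
HB.instance Definition _ := EqQuotient.on homology.

Definition homology_class (z : cycles) : homology :=
  \pi_(Quotient.quot boundaries) z.

Lemma homology_classP (y z : cycles) :
  reflect (exists x, bd C i x = val y - val z)
          (homology_class y == homology_class z).
Proof.
rewrite /homology_class -Quotient.idealrBE -raddfB; exact: asboolP.
Qed.

Lemma homology_classD : {morph homology_class : y z / y + z}.
Proof. by move=> y z; rewrite /homology_class raddfD. Qed.

Lemma repr_homology (z : homology) : homology_class (repr z) = z.
Proof. exact: reprK. Qed.

Definition homology_scale (a : R) (z : homology) : homology :=
  homology_class (a *: repr z).

Lemma homology_scaleE a (z : cycles) :
  homology_class (a *: z) = homology_scale a (homology_class z).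
Proof.
apply/eqP/homology_classP.
have /eqP/homology_classP [x hx] := repr_homology (homology_class z).
exists (- (a *: x)); rewrite [LHS]raddfN /= [bd C i (a *: x)]linearZ /= hx.
by rewrite scalerBr opprB !linearZ.
Qed.

Fact homology_scaleA a b v :
  homology_scale a (homology_scale b v) = homology_scale (a * b) v.
Proof. by rewrite -[v]repr_homology -!homology_scaleE scalerA. Qed.
Fact homology_scale1 : left_id 1 homology_scale.
Proof. by move=> v; rewrite -[v]repr_homology -homology_scaleE scale1r. Qed.
Fact homology_scaleDr : right_distributive homology_scale +%R.
Proof.
move=> a u v; rewrite -[u]repr_homology -[v]repr_homology.
by rewrite -homology_classD -!homology_scaleE -homology_classD scalerDr.
Qed.
Fact homology_scaleDl v : {morph homology_scale^~ v : a b / a + b}.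
Proof.
move=> a b /=; rewrite -[v]repr_homology.
by rewrite -!homology_scaleE -homology_classD scalerDl.
Qed.

HB.instance Definition _ := GRing.Zmodule_isLmodule.Build R homology
  homology_scaleA homology_scale1 homology_scaleDr homology_scaleDl.

Lemma homology_class_linear : linear homology_class.
Proof. by move=> a y z; rewrite homology_classD homology_scaleE. Qed.

HB.instance Definition _ := GRing.isLinear.Build R cycles homology _
  homology_class homology_class_linear.

End Homology.

Record chain_map (C D : chain) := ChainMap {
  chain_fun :> forall i, {linear C i -> D i};
  chain_fun_bd : forall i x,
    chain_fun i (bd C i x) = bd D i (chain_fun i.+1 x)
}.

Section HomologyMap.
Variables (C D : chain) (f : chain_map C D) (i : nat).

Lemma cycle_map_subproof (z : cycles C i) : f i (val z) \in @is_cycle D i.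
Proof.
case: z => x /=; rewrite /is_cycle; case: i x => [//|j] x /eqP hx.
by apply/eqP; rewrite -chain_fun_bd hx raddf0.
Qed.

Definition cycle_map (z : cycles C i) : cycles D i :=
  exist _ (f i (val z)) (cycle_map_subproof z).

Definition homology_map (z : homology C i) : homology D i :=
  homology_class (cycle_map (repr z)).

Lemma homology_map_class z :
  homology_map (homology_class z) = homology_class (cycle_map z).
Proof.
apply/eqP/homology_classP.
have /eqP/homology_classP [x hx] := repr_homology (homology_class z).
by exists (f i.+1 x); rewrite -chain_fun_bd hx raddfB.
Qed.

Lemma homology_map_linear : linear homology_map.
Proof.
move=> a u v; rewrite -[u]repr_homology -[v]repr_homology.
rewrite -linearP !homology_map_class -linearP.
by congr homology_class; apply: val_inj; rewrite /= !linearP.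
Qed.

HB.instance Definition _ := GRing.isLinear.Build R (homology C i)
  (homology D i) _ homology_map homology_map_linear.

End HomologyMap.

Arguments homology_map {C D} f i z.

Definition homology_isomorphism (C D : chain) (f : chain_map C D) : Prop :=
  forall i, bijective (homology_map f i).

Definition zero_chain (C : chain) : Prop := forall i, zero_module (C i).

Definition is_top_degree (C : chain) (d : nat) : Prop :=
  ~ zero_module (C d) /\ forall i, (d < i)%N -> zero_module (C i).

(* The default value -1 is taken when C = 0 (and also when C is unbounded,
   which does not happen for finite complexes). *)
Definition chain_dim (C : chain) : int :=
  xget (-1) (fun m : int => exists2 d : nat, m = d%:Z & is_top_degree C d).

Section Augmented.
Variables (C : chain) (e : {linear C 0 -> R^o}).
Hypothesis e_bd : forall x, e (bd C 0 x) = 0.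

(* Degrees are shifted by one: R sits in degree 0 and C_i in degree i + 1. *)
Definition augmented_ob (i : nat) : lmodType R :=
  if i is j.+1 then C j else R^o.

Definition augmented_bd (i : nat) :
    {linear augmented_ob i.+1 -> augmented_ob i} :=
  match i return {linear augmented_ob i.+1 -> augmented_ob i} with
  | 0 => e
  | j.+1 => bd C j
  end.

Lemma augmented_bd_bd i x : augmented_bd i (augmented_bd i.+1 x) = 0.
Proof. by case: i x => [|j] x; [exact: e_bd | exact: bd_bd]. Qed.

Definition augmented : chain := Chain augmented_bd_bd.

End Augmented.

(* [A] is an augmented complex, shifted as above, so that [homology A i] is
   the reduced homology in degree i - 1. *)
Definition reduced_homology_of_sphere (A : chain) (m : int) : Prop :=
  -1 <= m /\
  forall i : nat, if i%:Z - 1 == m then isomorphic_modules (homology A i) R^o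
                  else zero_module (homology A i).

End Modules.

Section OrbitCategory.
Local Open Scope group_scope.
Variable G : finGroupType.

Definition subgroup_family (F : {set {group G}}) : Prop :=
  [/\ F != finset.set0,
      forall (H : {group G}) (x : G), H \in F -> (H :^ x)%G \in F
    & forall H K : {group G}, H \in F -> K \subset H -> K \in F].

(* The G-set G/H of left cosets. *)
Definition Gorbit (H : {group G}) :=
  {A : {set G} | A \in lcosets H [set: G]}.

Lemma orbit_act_subproof (H : {group G}) (g : G) (A : Gorbit H) :
  g *: val A \in lcosets H [set: G].
Proof.
case: A => A /= /lcosetsP [x _ ->].
by apply/lcosetsP; exists (g * x); rewrite ?inE // lcosetM.
Qed.

Definition orbit_act (H : {group G}) (g : G) (A : Gorbit H) : Gorbit H :=
  exist _ (g *: val A) (orbit_act_subproof g A).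

Lemma orbit_base_subproof (H : {group G}) : gval H \in lcosets H [set: G].
Proof. by apply/lcosetsP; exists 1; rewrite ?inE // lcoset1. Qed.

Definition orbit_base (H : {group G}) : Gorbit H :=
  exist _ (gval H) (orbit_base_subproof H).

Definition equivariant (H K : {group G}) (f : {ffun Gorbit H -> Gorbit K}) :=
  [forall g, forall A, f (orbit_act g A) == orbit_act g (f A)].

Definition gmap (H K : {group G}) :=
  {f : {ffun Gorbit H -> Gorbit K} | equivariant f}.

Definition gmap_fun (H K : {group G}) (f : gmap H K) : Gorbit H -> Gorbit K :=
  val f.
Coercion gmap_fun : gmap >-> Funclass.

Lemma gmapE (H K : {group G}) (f : gmap H K) g A :
  f (orbit_act g A) = orbit_act g (f A).
Proof. by apply/eqP; have /forallP/(_ g)/forallP/(_ A) := valP f. Qed.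

Lemma gmap_id_subproof (H : {group G}) :
  equivariant [ffun A : Gorbit H => A].
Proof. by apply/forallP=> g; apply/forallP=> A; rewrite !ffunE. Qed.

Definition gmap_id (H : {group G}) : gmap H H :=
  exist _ [ffun A : Gorbit H => A] (gmap_id_subproof H).

Lemma gmap_comp_subproof (H K L : {group G}) (f' : gmap K L) (f : gmap H K) :
  equivariant [ffun A : Gorbit H => f' (f A)].
Proof. by apply/forallP=> g; apply/forallP=> A; rewrite !ffunE !gmapE. Qed.

Definition gmap_comp (H K L : {group G}) (f' : gmap K L) (f : gmap H K) :
    gmap H L :=
  exist _ [ffun A : Gorbit H => f' (f A)] (gmap_comp_subproof f' f).

Lemma gmap_idE (H : {group G}) A : gmap_id H A = A.
Proof. by rewrite /gmap_fun /= ffunE. Qed.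

Lemma gmap_compE (H K L : {group G}) (f' : gmap K L) (f : gmap H K) A :
  gmap_comp f' f A = f' (f A).
Proof. by rewrite /gmap_fun /= ffunE. Qed.

Section FixedPoints.
Variable H : {group G}.

Definition fixed_points (K : {group G}) :=
  {A : Gorbit H | [forall k in K, orbit_act k A == A]}.

Lemma orbit_actM (g h : G) (A : Gorbit H) :
  orbit_act (g * h)%g A = orbit_act g (orbit_act h A).
Proof. by apply: val_inj; rewrite /= lcosetM. Qed.

Lemma fixed_pointsP (K : {group G}) (A : fixed_points K) k :
  k \in K -> orbit_act k (val A) = val A.
Proof. by move=> kK; apply/eqP; have /forall_inP := valP A; apply. Qed.

Section Map.
Variables (K L : {group G}) (f : gmap K L).

Definition gmap_elt : G := fingroup.repr (val (f (orbit_base K))).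

Lemma gmap_eltE : val (f (orbit_base K)) = gmap_elt *: L.
Proof.
rewrite /gmap_elt; case: (f _) => A /= /lcosetsP [x _ ->].
by apply: lcoset_eqP; rewrite lcoset_sym; exact: (mem_repr _ (lcoset_refl L x)).
Qed.

Lemma fixed_points_map_subproof (A : fixed_points L) :
  [forall k in K, orbit_act k (orbit_act gmap_elt (val A))
                    == orbit_act gmap_elt (val A)].
Proof.
apply/forall_inP=> k kK; apply/eqP.
have hk : orbit_act k (orbit_base K) = orbit_base K.
  by apply: val_inj; rewrite /= lcoset_id.
have := congr1 val (gmapE f k (orbit_base K)).
rewrite hk /= gmap_eltE -lcosetM => /esym /lcoset_eqP.
rewrite mem_lcoset => kL.
by rewrite -[in RHS](fixed_pointsP A kL) -!orbit_actM mulKVg.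
Qed.

(* If f : G/K -> G/L maps K to gL, then f^* : (G/H)^L -> (G/H)^K is A |-> gA;
   under the identification of (G/H)^K with the G-maps G/K -> G/H this is
   composition with f. *)
Definition fixed_points_map (A : fixed_points L) : fixed_points K :=
  exist _ (orbit_act gmap_elt (val A)) (fixed_points_map_subproof A).

End Map.

Lemma fixed_points_map_id (K : {group G}) (A : fixed_points K) :
  fixed_points_map (gmap_id K) A = A.
Proof.
apply: val_inj => /=; apply: fixed_pointsP.
by rewrite /gmap_elt gmap_idE (mem_repr 1).
Qed.

Lemma fixed_points_map_comp (K L M : {group G}) (f : gmap K L)
    (f' : gmap L M) (A : fixed_points M) :
  fixed_points_map (gmap_comp f' f) A
    = fixed_points_map f (fixed_points_map f' A).
Proof.
apply: val_inj => /=; rewrite -orbit_actM.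
set g := gmap_elt _.
have : (g *: M = (gmap_elt f * gmap_elt f') *: M)%g.
  rewrite /g -gmap_eltE gmap_compE.
  have -> : f (orbit_base K) = orbit_act (gmap_elt f) (orbit_base L).
    by apply: val_inj; rewrite /= gmap_eltE.
  by rewrite gmapE /= gmap_eltE lcosetM.
move=> /lcoset_eqP; rewrite mem_lcoset => hg.
by rewrite -[in RHS](fixed_pointsP A hg) -!orbit_actM mulKVg.
Qed.

End FixedPoints.

Variables (R : nzRingType) (F : {set {group G}}).

(* Objects of the orbit category: K stands for the orbit G/K. *)
Definition orbit_cat := {K : {group G} | K \in F}.

Local Open Scope ring_scope.

Record rgmod := RGmod {
  rg_ob :> orbit_cat -> lmodType R;
  rg_map : forall H K : orbit_cat,
    gmap (val H) (val K) -> {linear rg_ob K -> rg_ob H};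
  rg_map_id : forall K x, rg_map (gmap_id (val K)) x = x;
  rg_map_comp : forall H K L (f : gmap (val H) (val K))
    (f' : gmap (val K) (val L)) x,
    rg_map (gmap_comp f' f) x = rg_map f (rg_map f' x)
}.

Record rgmor (M N : rgmod) := RGmor {
  rg_fun :> forall K, {linear M K -> N K};
  rg_fun_nat : forall H K (f : gmap (val H) (val K)) x,
    rg_fun H (rg_map M f x) = rg_map N f (rg_fun K x)
}.

Definition zero_rgmod (M : rgmod) : Prop := forall K, zero_module (M K).

Definition isomorphic_rgmods (M N : rgmod) : Prop :=
  exists f : rgmor M N, forall K, bijective (f K).

Definition const_map (H K : orbit_cat) (f : gmap (val H) (val K)) :
  {linear R^o -> R^o} := idfun.

Definition const_rgmod : rgmod :=
  @RGmod (fun _ => R^o) const_map (fun _ _ => erefl) (fun _ _ _ _ _ _ => erefl).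

Section BinarySum.
Variables M N : rgmod.

Definition sum_ob (K : orbit_cat) : lmodType R := (M K * N K)%type.

Section Map.
Variables (H K : orbit_cat) (f : gmap (val H) (val K)).

Definition sum_map_fun (x : sum_ob K) : sum_ob H :=
  (rg_map M f x.1, rg_map N f x.2).

Lemma sum_map_linear : linear sum_map_fun.
Proof. by move=> a x y; rewrite /sum_map_fun !linearP. Qed.

HB.instance Definition _ := GRing.isLinear.Build R (sum_ob K) (sum_ob H) _
  sum_map_fun sum_map_linear.

Definition sum_map : {linear sum_ob K -> sum_ob H} := sum_map_fun.
End Map.

Lemma sum_map_id K x : sum_map (gmap_id (val K)) x = x.
Proof. by case: x => x y; rewrite /= /sum_map_fun !rg_map_id. Qed.

Lemma sum_map_comp H K L (f : gmap (val H) (val K))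
    (f' : gmap (val K) (val L)) x :
  sum_map (gmap_comp f' f) x = sum_map f (sum_map f' x).
Proof. by rewrite /= /sum_map_fun !rg_map_comp. Qed.

Definition sum_rgmod : rgmod := RGmod sum_map_id sum_map_comp.

End BinarySum.

(* The module R[G/H^?], whose value at K is the free R-module on the K-fixed
   points of G/H. *)
Section Basic.
Variable H : {group G}.

Section Map.
Variables (K L : {group G}) (f : gmap K L).

Definition basic_map_fun (v : {ffun fixed_points H L -> R^o}) :
    {ffun fixed_points H K -> R^o} :=
  [ffun B => \sum_(A : fixed_points H L | fixed_points_map f A == B) v A].

Lemma basic_map_linear : linear basic_map_fun.
Proof.
move=> a u v; apply/ffunP=> B; rewrite !ffunE scaler_sumr -big_split /=.
by apply: eq_bigr => A _; rewrite !ffunE.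
Qed.

HB.instance Definition _ := GRing.isLinear.Build R
  {ffun fixed_points H L -> R^o} {ffun fixed_points H K -> R^o} _
  basic_map_fun basic_map_linear.

End Map.

Definition basic_ob (K : orbit_cat) : lmodType R :=
  {ffun fixed_points H (val K) -> R^o}.

Definition basic_map (K L : orbit_cat) (f : gmap (val K) (val L)) :
  {linear basic_ob L -> basic_ob K} := basic_map_fun f.

Lemma basic_map_id (K : orbit_cat) x : basic_map (gmap_id (val K)) x = x.
Proof.
apply/ffunP=> B; rewrite /= ffunE.
by under eq_bigl => A do rewrite fixed_points_map_id; rewrite big_pred1_eq.
Qed.

Lemma basic_map_comp (K L M : orbit_cat) (f : gmap (val K) (val L))
    (f' : gmap (val L) (val M)) x :
  basic_map (gmap_comp f' f) x = basic_map f (basic_map f' x).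
Proof.
apply/ffunP=> B; rewrite /= !ffunE.
rewrite (partition_big (fixed_points_map f')
  (fun A => fixed_points_map f A == B)) /=; last first.
  by move=> A; rewrite fixed_points_map_comp.
apply: eq_bigr => A /eqP hA; rewrite ffunE; apply: eq_bigl => A'.
rewrite fixed_points_map_comp; case: (eqVneq (fixed_points_map f' A') A).
  by move=> ->; rewrite hA eqxx.
by rewrite andbF.
Qed.

Definition basic_rgmod : rgmod := RGmod basic_map_id basic_map_comp.

End Basic.

(* M is the (possibly infinite) direct sum of the N_j along the maps i_j:
   objectwise, every element is a finite sum of elements i_j(y_j), in a
   unique way. *)
Definition is_direct_sum (J : eqType) (N : J -> rgmod) (M : rgmod)
    (inj : forall j, rgmor (N j) M) : Prop :=
  forall K : orbit_cat,
    (forall x : M K, exists (s : seq J) (y : forall j, N j K),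
        uniq s /\ x = \sum_(j <- s) inj j K (y j)) /\
    (forall (s : seq J) (y : forall j, N j K), uniq s ->
        \sum_(j <- s) inj j K (y j) = 0 -> forall j, j \in s -> y j = 0).

Definition free_rgmod (M : rgmod) : Prop :=
  exists (J : eqType) (H : J -> orbit_cat)
         (inj : forall j, rgmor (basic_rgmod (val (H j))) M),
    is_direct_sum inj.

Definition projective_rgmod (P : rgmod) : Prop :=
  exists M Q : rgmod, free_rgmod M /\ isomorphic_rgmods (sum_rgmod P Q) M.

Definition is_subrgmod (M : rgmod) (N : forall K, M K -> Prop) : Prop :=
  [/\ forall K, N K 0,
      forall K x y, N K x -> N K y -> N K (x + y),
      forall K a x, N K x -> N K (a *: x)
    & forall H K (f : gmap (val H) (val K)) x, N K x -> N H (rg_map M f x)].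

Definition finitely_generated_rgmod (M : rgmod) : Prop :=
  exists (m : nat) (K : 'I_m -> orbit_cat) (x : forall i, M (K i)),
    forall N : forall K, M K -> Prop,
      is_subrgmod N -> (forall i, N (K i) (x i)) -> forall L y, N L y.

Record rgchain := RGchain {
  rgc_ob :> nat -> rgmod;
  rgbd : forall i, rgmor (rgc_ob i.+1) (rgc_ob i);
  rgbd_rgbd : forall i K x, rgbd i K (rgbd i.+1 K x) = 0
}.

Definition finite_rgchain (C : rgchain) : Prop :=
  (exists d, forall i, (d <= i)%N -> zero_rgmod (C i)) /\
  (forall i, finitely_generated_rgmod (C i)).

Definition projective_rgchain (C : rgchain) : Prop :=
  forall i, projective_rgmod (C i).

Definition chain_at (C : rgchain) (K : orbit_cat) : chain R :=
  @Chain R (fun i => C i K) (fun i => rgbd C i K)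
    (fun i x => rgbd_rgbd x).

Definition res_chain_map (C : rgchain) (H K : orbit_cat)
    (f : gmap (val H) (val K)) : chain_map (chain_at C K) (chain_at C H) :=
  @ChainMap R (chain_at C K) (chain_at C H) (fun i => rg_map (C i) f)
    (fun i x => esym (rg_fun_nat (rgbd C i) f x)).

Definition Dim (C : rgchain) (H : {group G}) : int :=
  if insub H is Some K then chain_dim (chain_at C K) else -1.

Record augmentation (C : rgchain) := Augmentation {
  aug_mor :> rgmor (C 0) const_rgmod;
  aug_bd : forall K x, aug_mor K (rgbd C 0 K x) = 0;
  aug_surj : forall K, ~ zero_chain (chain_at C K) ->
    forall r : R, exists x, aug_mor K x = r
}.

Definition augmented_at (C : rgchain) (e : augmentation C) (K : orbit_cat) :
  chain R := @augmented R (chain_at C K) (e K) (fun x => aug_bd e x).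

Definition homology_sphere (C : rgchain) (n : {group G} -> int) : Prop :=
  exists e : augmentation C, forall K : orbit_cat,
    reduced_homology_of_sphere (augmented_at e K) (n (val K)).

Definition conjugation_invariant (n : {group G} -> int) : Prop :=
  forall H (x : G), n (H :^ x)%G = n H.

Definition supported_on (n : {group G} -> int) : Prop :=
  forall H, H \notin F -> n H = -1.

Definition subconjugate (H K : {group G}) : Prop :=
  exists g : G, (H :^ g)%g \subset K.

Definition monotone (n : {group G} -> int) : Prop :=
  forall H K, subconjugate H K -> n K <= n H.

Definition equal_dim_isomorphism (C : rgchain) (n : {group G} -> int) : Prop :=
  forall H K : orbit_cat, n (val K) = n (val H) ->
    forall f : gmap (val H) (val K), homology_isomorphism (res_chain_map C f).

Definition closed_under_join (n : {group G} -> int) : Prop :=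
  forall H K L : {group G}, H \in F -> K \in F -> L \in F ->
    H \subset K -> H \subset L ->
    n H = n K -> n K = n L -> -1 < n H ->
    (K <*> L)%G \in F /\ n (K <*> L)%G = n H.

Definition algebraic_homotopy_representation (C : rgchain)
    (n : {group G} -> int) : Prop :=
  [/\ [/\ finite_rgchain C, projective_rgchain C & homology_sphere C n],
      monotone n, equal_dim_isomorphism C n & closed_under_join n].

End OrbitCategory.

(* Main.v *)
(* On R[G/J^?] the restriction along f : G/H -> G/K is induced by an injection
   (G/J)^K -> (G/J)^H of bases; so on a projective module M it is injective with
   torsion-free cokernel, and for H <= K, L the submodules M(K) and M(L) of M(H)
   meet in M(<K,L>), or in 0 when <K,L> is not in F. Injectivity makes Dim C
   monotone. If n(H) = n(K) = d = dim C(H) = dim C(K), the reduced d-cycles of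
   both C(H) and C(K) form free modules of rank 1; torsion-freeness shows that
   those of C(K) map onto those of C(H), which is condition (ii). A nonzero
   d-cycle of C(H) then lies in both C_d(K) and C_d(L), hence comes from a nonzero
   element of C_d(<K,L>), which is condition (iii). *)
From HB Require Import structures.
From mathcomp Require Import all_boot all_order all_algebra all_fingroup.
From mathcomp Require Import generic_quotient.
From mathcomp Require Import boolp classical_sets.
Require Import Defs.

Set Implicit Arguments.
Unset Strict Implicit.
Unset Printing Implicit Defensive.

Import Order.TTheory GRing.Theory Num.Theory.
Local Open Scope ring_scope.

(** * Cycles, homology and dimension of chain complexes *)

Section Chains.
Variable R : nzRingType.

Lemma zero_homology_boundary (C : chain R) i (x : C i) :
  zero_module (homology C i) -> is_cycle x -> exists y, bd C i y = x.
Proof.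
move=> h0 hx; pose z : cycles C i := exist _ x hx.
have /eqP/homology_classP [y hy] : homology_class z = homology_class 0.
  by rewrite (h0 (homology_class z)) raddf0.
by exists y; rewrite hy subr0.
Qed.

(** With C_{i+1} = 0 there are no nonzero boundaries in degree i, so homology classes are cycles.
    The generator represents the class that f sends to 1, and it is nonzero because 1 is nonzero in
    R. *)
Lemma rank1_top_cycles (C : chain R) i :
  zero_module (C i.+1) -> isomorphic_modules (homology C i) R^o ->
  exists z : C i, [/\ is_cycle z, z <> 0 &
    forall x : C i, is_cycle x -> exists a, x = a *: z].
Proof.
move=> h0 [f [g fK gK]]; pose z := repr (g 1).
exists (val z); split; first exact: valP z.
  move=> hz; have z0 : z = 0 by apply: val_inj.
  have /(congr1 f) := repr_homology (g 1).
  rewrite -/z z0 [homology_class _]raddf0 [LHS]raddf0 gK.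
  by move=> /esym/eqP; rewrite (negPf (oner_neq0 R)).
move=> x hx; pose y : cycles C i := exist _ x hx.
pose a : R := f (homology_class y); exists a.
have /eqP/homology_classP [w] :
    homology_class y = homology_class (a *: z).
  apply: (can_inj fK); rewrite (homology_scaleE a z : _ = a *: (_ : homology C i)).
  by rewrite linearZ /= repr_homology gK /GRing.scale /= mulr1.
by rewrite (h0 w) raddf0 /= => /esym/eqP; rewrite subr_eq0 => /eqP.
Qed.

Lemma inj_surj_bijective (A B : Type) (f : A -> B) :
  injective f -> (forall y, exists x, f x = y) -> bijective f.
Proof.
by move=> f_inj /choice [g gK]; exists g => // x; apply: f_inj; rewrite gK.
Qed.

(** Restates the isomorphism on elements of the complexes, where the vanishing of reduced homology
    and the properties of restriction maps apply directly. *)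
Lemma homology_map_bijective (C D : chain R) (f : chain_map C D) i :
  (forall x : C i, is_cycle x ->
     (exists y, bd D i y = f i x) -> exists y, bd C i y = x) ->
  (forall y : D i, is_cycle y ->
     exists2 x : C i, is_cycle x & exists w, bd D i w = f i x - y) ->
  bijective (@homology_map _ C D f i).
Proof.
move=> f_inj f_surj; apply: inj_surj_bijective => [u v|y].
  rewrite -[u]repr_homology -[v]repr_homology !homology_map_class.
  move=> /eqP/homology_classP [w hw]; apply/eqP/homology_classP.
  apply: f_inj; last by exists w; rewrite hw raddfB.
  exact: (valP (repr u - repr v)).
rewrite -[y]repr_homology; have [x hx [w hw]] := f_surj _ (valP (repr y)).
exists (homology_class (exist _ x hx : cycles C i)).
by rewrite homology_map_class; apply/eqP/homology_classP; exists w.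
Qed.

Lemma chain_dim_top (C : chain R) d : is_top_degree C d -> chain_dim C = d%:Z.
Proof.
move=> [nz hd]; apply: xget_unique; first by exists d.
move=> _ [d' -> [nz' hd']]; congr Posz; apply/eqP; rewrite eqn_leq.
by apply/andP; split; rewrite leqNgt; apply/negP => lt;
  [apply: nz'; apply: hd | apply: nz; apply: hd'].
Qed.

(** Induction on the bound, discarding zero degrees from the top. Boundedness leaves the default
    value -1 of [chain_dim] to the zero complex alone. *)
Lemma chain_dimP (C : chain R) b :
  (forall i, (b <= i)%N -> zero_module (C i)) ->
  (zero_chain C /\ chain_dim C = -1) \/
  exists2 d, is_top_degree C d & chain_dim C = d%:Z.
Proof.
elim: b => [|b IHb] hb.
  left; split=> [i|]; first exact: hb.
  by apply: xgetPN => _ [d _ [nz _]]; apply: nz; apply: hb.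
case: (pselect (zero_module (C b))) => [z|nz].
  by apply: IHb => i; rewrite leq_eqVlt => /predU1P [<- //|]; apply: hb.
by right; exists b; [split | apply: chain_dim_top; split].
Qed.

End Chains.

(** * Direct sums, retracts and transfer from basic to projective modules *)

Section Transfer.
Variables (G : finGroupType) (R : nzRingType) (F : {set {group G}}).

Section Projections.
Variables (J : eqType) (N : J -> rgmod R F) (M : rgmod R F).
Variable inj : forall j, rgmor (N j) M.
Hypothesis sumM : is_direct_sum inj.

(** Vanishing outside s makes the family unique on all of J, independently of the list s. *)
Definition decomposes K (x : M K) (y : forall j, N j K) : Prop :=
  exists2 s : seq J, uniq s &
    (forall j, j \notin s -> y j = 0) /\ x = \sum_(j <- s) inj j K (y j).

Lemma decomposes_exists K (x : M K) : exists y, decomposes x y.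
Proof.
have [/(_ x) [s [y [us ->]]] _] := sumM K.
exists (fun j => if j \in s then y j else 0); exists s => //; split.
  by move=> j /negPf ->.
by rewrite big_seq [RHS]big_seq; apply: eq_bigr => j ->.
Qed.

(** Allows two decompositions with different supports to be added over a common index list. *)
Lemma sum_subseq K (y : forall j, N j K) (s t : seq J) : uniq s -> uniq t ->
  {subset s <= t} -> (forall j, j \notin s -> y j = 0) ->
  \sum_(j <- s) inj j K (y j) = \sum_(j <- t) inj j K (y j).
Proof.
move=> us ut st hy; rewrite [RHS](bigID (mem s)) /= [X in _ + X]big1 ?addr0.
  rewrite -[RHS]big_filter; apply: perm_big; apply: uniq_perm => //.
    exact: filter_uniq.
  by move=> j; rewrite mem_filter; case: (boolP (j \in s)) => // /st ->.
by move=> j /hy ->; rewrite raddf0.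
Qed.

Lemma decomposes_lin K a (x x' : M K) y y' : decomposes x y ->
  decomposes x' y' -> decomposes (a *: x + x') (fun j => a *: y j + y' j).
Proof.
move=> [s us [hs ->]] [s' us' [hs' ->]].
exists (undup (s ++ s')); first exact: undup_uniq.
split=> [j|].
  by rewrite mem_undup mem_cat negb_or => /andP [/hs -> /hs' ->]; rewrite scaler0 addr0.
have sub1 : {subset s <= undup (s ++ s')}.
  by move=> j hj; rewrite mem_undup mem_cat hj.
have sub2 : {subset s' <= undup (s ++ s')}.
  by move=> j hj; rewrite mem_undup mem_cat hj orbT.
rewrite (sum_subseq us _ sub1) ?undup_uniq //.
rewrite (sum_subseq us' _ sub2) ?undup_uniq //.
rewrite scaler_sumr -big_split /=; apply: eq_bigr => j _.
by rewrite linearP.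
Qed.

Lemma decomposes_map H K (f : gmap (val H) (val K)) (x : M K) y :
  decomposes x y -> decomposes (rg_map M f x) (fun j => rg_map (N j) f (y j)).
Proof.
move=> [s us [hs ->]]; exists s => //; split=> [j /hs ->|].
  by rewrite raddf0.
by rewrite raddf_sum; apply: eq_bigr => j _; rewrite rg_fun_nat.
Qed.

Lemma decomposes_unique K (x : M K) y y' :
  decomposes x y -> decomposes x y' -> forall j, y j = y' j.
Proof.
move=> hy hy' j; have := decomposes_lin (-1) hy hy'.
rewrite scaleN1r addNr => -[s us [hs h0]].
have {}h0 : - y j + y' j = 0.
  rewrite -scaleN1r.
  case: (boolP (j \in s)) => [js|/hs //].
  by have [_ /(_ s _ us (esym h0) j js)] := sumM K.
by apply/eqP; rewrite eq_sym -subr_eq0 addrC h0.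
Qed.

(** A classical choice. Uniqueness of decompositions makes it canonical, which yields linearity and
    naturality of the projections. *)
Definition component K (x : M K) : forall j, N j K :=
  projT1 (cid (decomposes_exists x)).

Lemma decomposes_component K (x : M K) : decomposes x (component x).
Proof. exact: projT2 (cid (decomposes_exists x)). Qed.

Definition projection_fun j K (x : M K) : N j K := component x j.

Lemma projection_linear j K : linear (@projection_fun j K).
Proof.
move=> a x x'; exact: (decomposes_unique (decomposes_component _)
  (decomposes_lin a (decomposes_component x) (decomposes_component x')) j).
Qed.

HB.instance Definition _ j K := GRing.isLinear.Build R (M K) (N j K) _
  (@projection_fun j K) (@projection_linear j K).

Lemma projection_nat j H K (f : gmap (val H) (val K)) (x : M K) :
  projection_fun j (rg_map M f x) = rg_map (N j) f (projection_fun j x).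
Proof.
exact: (decomposes_unique (decomposes_component _)
  (decomposes_map f (decomposes_component x)) j).
Qed.

Definition projection j : rgmor M (N j) :=
  @RGmor _ _ _ M (N j) (fun K => @projection_fun j K) (@projection_nat j).

Lemma sum_projection K (x : M K) :
  exists s : seq J, x = \sum_(j <- s) inj j K (projection j K x).
Proof. by have [s _ [_ hs]] := decomposes_component x; exists s. Qed.

End Projections.

Section Summands.
Variables M N : rgmod R F.

Definition sum_inl_fun K (x : M K) : sum_rgmod M N K := (x, 0).

Lemma sum_inl_linear K : linear (@sum_inl_fun K).
Proof. by move=> a x y; congr pair; rewrite /= scaler0 addr0. Qed.

HB.instance Definition _ K := GRing.isLinear.Build R (M K) (sum_rgmod M N K) _
  (@sum_inl_fun K) (@sum_inl_linear K).

Lemma sum_inl_nat H K (f : gmap (val H) (val K)) (x : M K) :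
  sum_inl_fun (rg_map M f x) = rg_map (sum_rgmod M N) f (sum_inl_fun x).
Proof. by congr pair; rewrite raddf0. Qed.

Definition sum_inl : rgmor M (sum_rgmod M N) :=
  @RGmor _ _ _ M (sum_rgmod M N) (fun K => @sum_inl_fun K) (@sum_inl_nat).

Definition sum_fst_fun K (x : sum_rgmod M N K) : M K := x.1.

Lemma sum_fst_linear K : linear (@sum_fst_fun K).
Proof. by []. Qed.

HB.instance Definition _ K := GRing.isLinear.Build R (sum_rgmod M N K) (M K) _
  (@sum_fst_fun K) (@sum_fst_linear K).

Definition sum_fst : rgmor (sum_rgmod M N) M :=
  @RGmor _ _ _ (sum_rgmod M N) M (fun K => @sum_fst_fun K)
    (fun _ _ _ _ => erefl).

Variables (g : rgmor M N) (h : forall K, N K -> M K).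
Hypotheses (gK : forall K, cancel (g K) (@h K)).
Hypotheses (hK : forall K, cancel (@h K) (g K)).

Lemma inverse_linear K : linear (@h K).
Proof. exact: can2_linear (gK (K:=K)) (hK (K:=K)). Qed.

HB.instance Definition _ K := GRing.isLinear.Build R (N K) (M K) _
  (@h K) (@inverse_linear K).

Lemma inverse_nat H K (f : gmap (val H) (val K)) (x : N K) :
  h (rg_map N f x) = rg_map M f (h x).
Proof. by apply: (can_inj (@gK H)); rewrite hK rg_fun_nat hK. Qed.

Definition inverse_rgmor : rgmor N M :=
  @RGmor _ _ _ N M (fun K => @h K) (@inverse_nat).

End Summands.

Section NaturalPredicates.
Variables (K : orbit_cat F) (P Q : forall N : rgmod R F, N K -> Prop).
Hypothesis P_mor : forall M N (g : rgmor M N) x, P x -> P (g K x).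
Hypothesis Q_mor : forall M N (g : rgmor M N) x, Q x -> Q (g K x).
Hypothesis Q_0 : forall N : rgmod R F, Q (0 : N K).
Hypothesis Q_D : forall (N : rgmod R F) (x y : N K), Q x -> Q y -> Q (x + y).

(** Every x is a finite sum of images of its components. P passes to each component by naturality,
    the basic case turns it into Q, and Q survives the injections and finite sums. *)
Lemma free_transfer (M : rgmod R F) :
  (forall (H : orbit_cat F) (x : basic_rgmod R F (val H) K), P x -> Q x) ->
  free_rgmod M -> forall x : M K, P x -> Q x.
Proof.
move=> PQ [J [H [inj sumM]]] x Px; have [s ->] := sum_projection sumM x.
elim: s => [|j s IHs]; first by rewrite big_nil.
by rewrite big_cons; apply: Q_D => //; apply: Q_mor; apply: PQ; apply: P_mor.
Qed.

(** M is a retract of a free module: P is pushed forward to the free module, and Q is carried back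
    along the retraction, which returns x itself. *)
Lemma projective_transfer (M : rgmod R F) :
  (forall (H : orbit_cat F) (x : basic_rgmod R F (val H) K), P x -> Q x) ->
  projective_rgmod M -> forall x : M K, P x -> Q x.
Proof.
move=> PQ [M' [N [freeN [f bij_f]]]] x Px.
have hE L : exists h, cancel (f L) h /\ cancel h (f L).
  by case: (bij_f L) => h; exists h.
pose h L := projT1 (cid (hE L)).
have fK L : cancel (f L) (h L) by case: (projT2 (cid (hE L))).
have hK L : cancel (h L) (f L) by case: (projT2 (cid (hE L))).
have -> : x = sum_fst M N K (inverse_rgmor fK hK K (f K (sum_inl M N K x))).
  by rewrite /= fK.
do 2?apply: Q_mor; apply: free_transfer => //; do 2?apply: P_mor; exact: Px.
Qed.
End NaturalPredicates.
End Transfer.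

(** * Fixed points of orbits and inclusions of subgroups *)

Section OrbitMaps.
Variable G : finGroupType.
Local Open Scope group_scope.

(** The map is translation by [gmap_elt f], which the inverse element undoes. *)
Lemma fixed_points_map_inj (J H K : {group G}) (f : gmap H K) :
  injective (@fixed_points_map G J H K f).
Proof.
move=> A B /(congr1 (fun D => orbit_act ((gmap_elt f)^-1) (val D))) /=.
rewrite -!orbit_actM mulVg => eqAB; apply: val_inj; apply: val_inj.
by move/(congr1 val): eqAB; rewrite /= !lcoset1.
Qed.

Section Inclusion.
Variables H K : {group G}.
Hypothesis sHK : H \subset K.

Lemma inclusion_ob_subproof (A : Gorbit H) : val A * K \in lcosets K [set: G].
Proof.
case: A => A /= /lcosetsP [x _ ->].
by apply/lcosetsP; exists x; rewrite ?inE // -mulgA mulSGid.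
Qed.

Definition inclusion_ob (A : Gorbit H) : Gorbit K :=
  exist _ (val A * K) (inclusion_ob_subproof A).

Lemma inclusion_equivariant : equivariant [ffun A => inclusion_ob A].
Proof.
apply/forallP=> g; apply/forallP=> A; rewrite !ffunE.
by apply/eqP/val_inj; rewrite /= mulgA.
Qed.

Definition inclusion : gmap H K :=
  exist (fun f => equivariant f) _ inclusion_equivariant.

Lemma inclusion_elt : gmap_elt inclusion \in K.
Proof.
have := gmap_eltE inclusion; rewrite /gmap_fun /= ffunE /= mulSGid // => ->.
exact: lcoset_refl.
Qed.

(** The representative [gmap_elt] of the coset K need not be 1, but it lies in K and therefore fixes
    A. *)
Lemma val_fixed_points_inclusion (J : {group G}) (A : fixed_points J K) :
  val (fixed_points_map inclusion A) = val A.
Proof. exact: (fixed_pointsP A inclusion_elt). Qed.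

End Inclusion.

(** The stabilizer of yJ is the conjugate of J by y, which in the right-action notation is
    [J :^ y^-1]. *)
Lemma orbit_stabilizer (J : {group G}) (A : Gorbit J) :
  exists x, forall k, (orbit_act k A == A) = (k \in J :^ x).
Proof.
case: A => A hA; have /lcosetsP [y _ eA] := hA.
exists y^-1 => k; rewrite -val_eqE /= eA -lcosetM mem_conjg invgK.
rewrite conjgE -mem_lcoset; exact/eqP/lcoset_eqP.
Qed.

End OrbitMaps.

(** * Restriction maps of basic modules *)

Section BasicModules.
Variables (G : finGroupType) (R : nzRingType) (J : {group G}).

Lemma basic_map_funE (H K : {group G}) (f : gmap H K)
    (v : {ffun fixed_points J K -> R^o}) A :
  basic_map_fun f v (fixed_points_map f A) = v A.
Proof.
rewrite ffunE (big_pred1 A) // => A'.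
by rewrite /= (inj_eq (@fixed_points_map_inj _ J _ _ f)).
Qed.

(** Restriction sends basis elements injectively to basis elements, so its image is cut out by a
    condition on supports. Purity and intersections of images thereby become statements about
    supports. *)
Lemma basic_map_image (H K : {group G}) (f : gmap H K)
    (y : {ffun fixed_points J H -> R^o}) :
  (exists x, basic_map_fun f x = y) <->
  (forall B, y B <> 0 -> exists A, fixed_points_map f A = B).
Proof.
split=> [[x <-] B|hy].
  apply: contra_notP => hB; rewrite ffunE big1 // => A /eqP hA.
  by case: hB; exists A.
exists [ffun A => y (fixed_points_map f A)]; apply/ffunP=> B.
case: (pselect (y B = 0)) => [y0|/hy [A <-]]; last by rewrite basic_map_funE ffunE.
by rewrite ffunE big1 ?y0 // => A /eqP hA; rewrite ffunE hA.
Qed.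

End BasicModules.

(** * Restriction maps of projective modules *)

Section ProjectiveModules.
Variables (G : finGroupType) (R : idomainType) (F : {set {group G}}).
Variable M : rgmod R F.
Hypothesis projM : projective_rgmod M.

(** Transfer with P: killed by f, and Q: zero. On a basic module every coefficient can be read off
    the restriction. *)
Lemma rg_map_inj (H K : orbit_cat F) (f : gmap (val H) (val K)) :
  injective (rg_map M f).
Proof.
apply: raddf_inj => x fx0.
pose P (N : rgmod R F) (x : N K) := rg_map N f x = 0.
apply: (@projective_transfer _ _ _ K P (fun N x => x = 0)) projM _ fx0 => //.
- by move=> N N' g y hy; rewrite /P -rg_fun_nat hy raddf0.
- by move=> N N' g y ->; rewrite raddf0.
- by move=> N y y' -> ->; rewrite addr0.
move=> J y /= y0; apply/ffunP=> A.
by rewrite -(basic_map_funE f y A) [basic_map_fun f y]y0 !ffunE.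
Qed.

(** On a basic module, scaling by a nonzero element of a domain leaves the support unchanged, and
    the support alone decides membership in the image. *)
Lemma rg_map_pure (H K : orbit_cat F) (f : gmap (val H) (val K)) a (y : M H) :
  a != 0 -> (exists x, rg_map M f x = a *: y) -> exists x, rg_map M f x = y.
Proof.
move=> a0.
pose P (N : rgmod R F) (y : N H) := exists x, rg_map N f x = a *: y.
pose Q (N : rgmod R F) (y : N H) := exists x, rg_map N f x = y.
apply: (@projective_transfer _ _ _ H P Q) projM _ => //.
- by move=> N N' g z [x hx]; exists (g K x); rewrite -rg_fun_nat hx linearZ.
- by move=> N N' g z [x hx]; exists (g K x); rewrite -rg_fun_nat hx.
- by move=> N; exists 0; rewrite raddf0.
- by move=> N z z' [x hx] [x' hx']; exists (x + x'); rewrite linearD hx hx'.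
move=> J z /basic_map_image hz; apply/basic_map_image => B zB; apply: hz.
by apply/eqP; rewrite ffunE mulf_neq0 //; apply/eqP.
Qed.

(** On a basic module, a vector in both images is supported on cosets fixed by K and by L, hence by
    the join; it then comes from the join as well. *)
Lemma rg_map_join (H K L : orbit_cat F) (sHK : val H \subset val K)
    (sHL : val H \subset val L) (y : M H) :
  subgroup_family F ->
  (exists x, rg_map M (inclusion sHK) x = y) ->
  (exists x, rg_map M (inclusion sHL) x = y) ->
  y <> 0 ->
  exists2 U : orbit_cat F, val U = (val K <*> val L)%G & exists x : M U, x <> 0.
Proof.
move=> [_ conjF subF] hK hL.
pose P (N : rgmod R F) (y : N H) := (exists x, rg_map N (inclusion sHK) x = y) /\
  (exists x, rg_map N (inclusion sHL) x = y).
have P_mor (N N' : rgmod R F) (g : rgmor N N') z : P N z -> P N' (g H z).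
  by move=> [[x hx] [x' hx']]; split; [exists (g K x) | exists (g L x')];
    rewrite -rg_fun_nat ?hx ?hx'.
have supp (J : {group G}) (z : basic_rgmod R F J H) : P _ z ->
    forall B, z B <> 0 -> exists x, (val K <*> val L)%g \subset (J :^ x)%G /\
      forall k, (orbit_act k (val B) == val B) = (k \in (J :^ x)%g).
  move=> [/basic_map_image zK /basic_map_image zL] B zB.
  have [x hx] := orbit_stabilizer (val B); exists x; split=> //.
  rewrite join_subG; apply/andP; split; apply/fintype.subsetP => k kin.
    rewrite -hx; have [A <-] := zK _ zB.
    by rewrite val_fixed_points_inclusion (fixed_pointsP A kin).
  rewrite -hx; have [A <-] := zL _ zB.
  by rewrite val_fixed_points_inclusion (fixed_pointsP A kin).
case: (boolP ((val K <*> val L)%G \in F)) => UF; last first.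
  (* A coset in the support would have a conjugate of J as stabilizer. This lies in F and contains
     the join, which would put the join in F; so y = 0, against the assumption. *)
  case; apply: (@projective_transfer _ _ _ H P (fun N y => y = 0)) projM _ _ => //.
  - by move=> N N' g z ->; rewrite raddf0.
  - by move=> N z z' -> ->; rewrite addr0.
  move=> J z /supp hz; apply/ffunP=> B; rewrite ffunE.
  apply/notP => /hz [x [sub _]]; case/negP: UF.
  by apply: subF sub; apply: conjF; apply: valP.
pose U : orbit_cat F := exist (fun H => H \in F) _ UF.
have sHU : val H \subset val U by apply: fintype.subset_trans sHK (joing_subl _ _).
pose Q (N : rgmod R F) (y : N H) := exists x, rg_map N (inclusion sHU) x = y.
have [x hx] : Q M y.
- apply: (@projective_transfer _ _ _ H P Q) projM _ _ => //.
  + by move=> N N' g z [x hx]; exists (g U x); rewrite -rg_fun_nat hx.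
  + by move=> N; exists 0; rewrite raddf0.
  + by move=> N z z' [x hx] [x' hx']; exists (x + x'); rewrite linearD hx hx'.
  move=> J z /supp hz; apply/basic_map_image => B /hz [x [sub hx]].
  have BU : [forall k in val U, orbit_act k (val B) == val B].
    by apply/forall_inP=> k kU; rewrite hx (fintype.subsetP sub).
  exists (exist (fun A : Gorbit (val J) =>
    [forall k in val U, orbit_act k A == A]) _ BU); apply: val_inj.
  exact: val_fixed_points_inclusion.
by move=> y0; exists U => //; exists x => x0; apply: y0; rewrite -hx x0 raddf0.
Qed.
End ProjectiveModules.

(** * Homology spheres whose dimension function is [Dim C] *)

Section Spheres.
Variables (G : finGroupType) (R : idomainType) (F : {set {group G}}).
Variables (C : rgchain R F) (n : {group G} -> int) (e : augmentation C).
Hypothesis finC : finite_rgchain C.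
Hypothesis projC : projective_rgchain C.
Hypothesis sphereC :
  forall K, reduced_homology_of_sphere (augmented_at e K) (n (val K)).
Hypothesis dimC : forall H, n H = Dim C H.

Lemma sphere_dim (K : orbit_cat F) :
  (zero_chain (chain_at C K) /\ n (val K) = -1) \/
  exists2 d, is_top_degree (chain_at C K) d & n (val K) = d%:Z.
Proof.
have [[b hb] _] := finC; rewrite dimC /Dim valK.
by apply: (@chain_dimP _ _ b) => i bi x; apply: hb.
Qed.

Lemma sphere_top (K : orbit_cat F) d :
  n (val K) = d%:Z -> is_top_degree (chain_at C K) d.
Proof.
by case: (sphere_dim K) => [[_ ->]//|[d' top ->]] [<-].
Qed.

(** C_i sits in degree i + 1 of the augmented complex, so [augmented_bd i] starts at C_i. The
    condition differs from [is_cycle] only for i = 0, where it is the kernel of the augmentation. *)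
Definition reduced_cycle (K : orbit_cat F) i (x : C i K) : Prop :=
  @augmented_bd _ (chain_at C K) (e K) i x = 0.

Lemma reduced_cycle_map (H K : orbit_cat F) (f : gmap (val H) (val K)) i
    (x : C i K) : reduced_cycle x -> reduced_cycle (rg_map (C i) f x).
Proof.
rewrite /reduced_cycle; case: i x => [|i] x /= hx.
  by rewrite rg_fun_nat /= /const_map /= hx.
by rewrite rg_fun_nat hx raddf0.
Qed.

Lemma reduced_boundary (K : orbit_cat F) i (x : C i K) :
  n (val K) <> i%:Z -> reduced_cycle x -> exists y, rgbd C i K y = x.
Proof.
move=> ni hx; have [_ /(_ i.+1)] := sphereC K.
case: eqP => [eqn|_ h0]; first by case: ni; rewrite -eqn -addn1 PoszD addrK.
by apply: (zero_homology_boundary (C := augmented_at e K) (i := i.+1) h0); apply/eqP.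
Qed.

Lemma sphere_augmentation_surj (K : orbit_cat F) (r : R) :
  n (val K) <> -1 -> exists x, e K x = r.
Proof.
move=> n1; apply: aug_surj => z; apply: n1.
by case: (sphere_dim K) => [[_ //]|[d [nz _] _]]; case: nz; apply: z.
Qed.

(** As n is the dimension function, C_{d+1}(K) = 0, and the reduced homology R in degree d is the
    module of reduced d-cycles itself. *)
Lemma top_cycle_generator (K : orbit_cat F) d : n (val K) = d%:Z ->
  exists z : C d K, [/\ reduced_cycle z, z <> 0 &
    forall x : C d K, reduced_cycle x -> exists a, x = a *: z].
Proof.
move=> nd; have [_ /(_ d.+1)] := sphereC K.
rewrite nd -addn1 PoszD addrK eqxx addn1 => iso.
have z : zero_module (augmented_at e K d.+2) by have [_] := sphere_top nd; apply.
have [x [/eqP xc x0 xg]] := rank1_top_cycles z iso.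
by exists x; split=> // y /eqP yc; apply: xg.
Qed.

(* The restriction of a nonzero top cycle of [C(K)] is [a *: z] with [a != 0]
   and [z] a generator of the top cycles of [C(H)]; purity of the image then
   puts [z] itself in the image. *)
Lemma top_cycle_image (H K : orbit_cat F) (f : gmap (val H) (val K)) d
    (y : C d H) : n (val H) = d%:Z -> n (val K) = d%:Z -> reduced_cycle y ->
  exists x, rg_map (C d) f x = y.
Proof.
move=> nH nK yc; have [z [zc z0 zg]] := top_cycle_generator nH.
have [u [uc u0 _]] := top_cycle_generator nK.
have [a fu] := zg _ (reduced_cycle_map f uc).
have a0 : a != 0.
  apply/eqP => a0; apply: u0; apply: (rg_map_inj (projC d) (f := f)).
  by rewrite fu a0 scale0r raddf0.
have [x fx] : exists x, rg_map (C d) f x = z.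
  by apply: (rg_map_pure (projC d) a0); exists u.
have [b ->] := zg _ yc; exists (b *: x).
by rewrite linearZ fx.
Qed.

(** Restriction from K to H is injective, so C_d(K) nonzero in its top degree d forces C_d(H)
    nonzero. *)
Lemma sphere_subset_monotone (H K : {group G}) : subgroup_family F ->
  H \subset K -> n K <= n H.
Proof.
move=> [_ _ subF] sHK.
have n_ge (U : {group G}) : -1 <= n U.
  rewrite dimC /Dim; case: insubP => [U' _ _|//].
  have := dimC (val U'); rewrite /Dim valK => <-.
  by case: (sphere_dim U') => [[_ ->]|[d _ ->]].
(* Outside F the value is -1, the least one possible. *)
case: (boolP (K \in F)) => KF; last first.
  by rewrite dimC /Dim insubN // n_ge.
pose K' : orbit_cat F := exist (fun K => K \in F) K KF.
pose H' : orbit_cat F := exist (fun K => K \in F) H (subF _ _ KF sHK).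
case: (sphere_dim K') => [[_ /= ->]|[d [nz _] /= ->]]; first exact: n_ge.
have nzH : ~ zero_module (C d H').
  move=> zH; apply: nz => x.
  by apply: (rg_map_inj (projC d) (f := @inclusion _ (val H') (val K') sHK));
    rewrite raddf0; apply: zH.
case: (sphere_dim H') => [[z _]|[d' [_ hd'] /= ->]]; first by case: nzH; apply: z.
rewrite lez_nat leqNgt; apply/negP => lt; apply: nzH; exact: hd'.
Qed.

Lemma sphere_monotone : subgroup_family F -> conjugation_invariant n ->
  monotone n.
Proof.
move=> hF conjn H K [g sHK]; rewrite -(conjn H g).
exact: sphere_subset_monotone.
Qed.

(** Restriction commutes with the differential and is injective one degree lower. *)
Lemma cycle_reflect (H K : orbit_cat F) (f : gmap (val H) (val K)) i
    (x : C i K) :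
  @is_cycle _ (chain_at C H) i (rg_map (C i) f x) ->
  @is_cycle _ (chain_at C K) i x.
Proof.
case: i x => [//|i] x /eqP /= hx; apply/eqP.
by apply: (rg_map_inj (projC i) (f := f)); rewrite raddf0 -rg_fun_nat.
Qed.

(** Bridges ordinary homology, used in condition (ii), and reduced homology, used for spheres. In
    degree 0 one subtracts the restriction of an element with the same augmentation; in higher
    degrees x = 0 suffices. *)
Lemma cycle_correction (H K : orbit_cat F) (f : gmap (val H) (val K)) i
    (y : C i H) : n (val K) <> -1 -> @is_cycle _ (chain_at C H) i y ->
  exists2 x, @is_cycle _ (chain_at C K) i x & reduced_cycle (y - rg_map (C i) f x).
Proof.
case: i y => [|i] y nK yc.
  have [x hx] := sphere_augmentation_surj (e H y) nK.
  exists x => //.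
  by rewrite /reduced_cycle /= linearB rg_fun_nat /= /const_map /= hx subrr.
exists 0; first exact: (is_cycle_submod_closed (chain_at C K) i.+1).1.
by rewrite /reduced_cycle raddf0 subr0; apply/eqP.
Qed.

(** Away from degree d reduced cycles bound on both sides. In degree d there are no nonzero
    boundaries, and [top_cycle_image] lifts reduced cycles. *)
Lemma sphere_equal_dim : equal_dim_isomorphism C n.
Proof.
move=> H K nKH f i; case: (sphere_dim H) => [[zH nH]|[d [_ topH] nH]].
  have zK : zero_chain (chain_at C K).
    case: (sphere_dim K) => [[]//|[d _]].
    by rewrite nKH nH.
  apply: homology_map_bijective => [x _ _|y _].
    by exists 0; rewrite raddf0; apply/esym/zK.
  exists 0; first exact: (is_cycle_submod_closed (chain_at C K) i).1.
  by exists 0; rewrite !raddf0 (zH _ y) subr0.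
have nK : n (val K) = d%:Z by rewrite nKH.
apply: homology_map_bijective => [x xc [y /= hy]|y yc].
  case: (eqVneq i d) => [eid|nid].
    have y0 : y = 0 by apply: topH; rewrite eid.
    exists 0; rewrite raddf0; apply: (rg_map_inj (projC i) (f := f)).
    by rewrite raddf0 -hy y0 raddf0.
  apply: reduced_boundary; first by rewrite nK => -[eid]; rewrite eid eqxx in nid.
  (* For i = 0, x has the same augmentation as its restriction, which is a boundary and so is sent
     to 0. *)
  case: i x y xc hy {nid} => [|i] x y xc hy; last exact/eqP.
  by have := rg_fun_nat e f x; rewrite -hy aug_bd => /esym.
have nK1 : n (val K) <> -1 by rewrite nK.
have [x0 x0c yr] := cycle_correction f nK1 yc.
case: (eqVneq i d) => [eid|nid].
  move: yr x0c yc; rewrite -eid in nH nK => yr x0c yc.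
  have [x1 hx1] := top_cycle_image f nH nK yr.
  (* x0 accounts for the augmentation and x1 lifts the remaining reduced cycle, so y is hit
     exactly. *)
  have hx : rg_map (C i) f (x0 + x1) = y by rewrite raddfD /= hx1 addrC subrK.
  exists (x0 + x1); first by apply: (cycle_reflect (f := f)); rewrite hx.
  by exists 0; rewrite raddf0 /= hx subrr.
exists x0 => //; have [|w hw] := reduced_boundary _ yr.
  by rewrite nH => -[eid]; rewrite eid eqxx in nid.
by exists (- w); rewrite raddfN /= hw opprB.
Qed.

(** A nonzero top cycle of C(H) is restricted from both K and L, so C_d is nonzero at the join and
    the value there is at least d; monotonicity gives the other inequality. *)
Lemma sphere_closed_under_join : subgroup_family F ->
  closed_under_join F n.
Proof.
move=> hF H K L HF KF LF sHK sHL nHK nKL nH1.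
pose H' : orbit_cat F := exist (fun K => K \in F) H HF.
pose K' : orbit_cat F := exist (fun K => K \in F) K KF.
pose L' : orbit_cat F := exist (fun K => K \in F) L LF.
case: (sphere_dim H') => [[_ /= nH]|[d _ /= nH]]; first by rewrite nH in nH1.
have nK : n (val K') = d%:Z by rewrite -nH -nHK.
have nL : n (val L') = d%:Z by rewrite -nH nHK -nKL.
have [z [zc z0 _]] := top_cycle_generator (nH : n (val H') = _).
have [U eU [x x0]] := rg_map_join (projC d) hF
  (top_cycle_image (@inclusion _ (val H') (val K') sHK) nH nK zc)
  (top_cycle_image (@inclusion _ (val H') (val L') sHL) nH nL zc) z0.
rewrite -eU; split; first exact: valP.
apply/eqP; rewrite eq_le (sphere_subset_monotone hF) /=; last first.
  by rewrite eU; apply: fintype.subset_trans sHK (joing_subl _ _).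
rewrite nH; case: (sphere_dim U) => [[zU _]|[d' [_ topU] ->]].
  by case: x0; apply: zU.
by rewrite lez_nat leqNgt; apply/negP => lt; apply: x0; apply: topU.
Qed.

End Spheres.

Theorem proposition2p10 (G : finGroupType) (F : {set {group G}})
    (hF : subgroup_family F) (R : idomainType) (hR : is_pid R)
    (n : {group G} -> int)
    (hn_conj : conjugation_invariant n) (hn_supp : supported_on F n)
    (C : rgchain R F)
    (hC_fin : finite_rgchain C) (hC_proj : projective_rgchain C)
    (hC_sphere : homology_sphere C n)
    (hdim : forall H : {group G}, n H = Dim C H) :
  algebraic_homotopy_representation C n.
Proof.
have [e sphereC] := hC_sphere; split=> //.
- exact: (sphere_monotone hC_fin hC_proj hdim hF hn_conj).
- exact: (sphere_equal_dim hC_fin hC_proj sphereC hdim).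
- exact: (sphere_closed_under_join hC_fin hC_proj sphereC hdim hF).
Qed.
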